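(* In the setting of the context, assume $\mathbf{A}$ and $\tilde{\mathbf{A}}$ are invertible, $\mathbf{Q}_\Delta$ is given by the LU trick, and the number $M$ of quadrature nodes satisfies $M\le M^*$, where $M^*$ (depending on the matrix norm) is such that the modified smoother $\mathbf{T}_2=\mathbf{I}_{LMN}-\hat{\mathbf{P}}_2^{-1}\mathbf{C}$ satisfies the smoothing property $\|\mathbf{C}\mathbf{T}_2^k\|\le c\sqrt{8/(k\pi)}\,\mu$ for all $k$ and all sufficiently large $\mu$. Let $\mathbf{T}_{\mathrm{PFASST}}(\mu,k)=\big(\mathbf{I}_{LMN}-\mathbf{T}_C^F\tilde{\mathbf{P}}^{-1}\mathbf{T}_F^C\mathbf{C}\big)\big(\mathbf{I}_{LMN}-\hat{\mathbf{P}}_2^{-1}\mathbf{C}\big)^k$ be the iteration matrix of PFASST with $k$ modified approximative block Jacobi pre-smoothing steps. Then there exist $c>0$ and $\mu^*>0$ such that for all $k\in\mathbb{N}$ and all $\mu\ge\mu^*$, $$\big\|\mathbf{T}_{\mathrm{PFASST}}(\mu,k)\big\|\le g(k),\qquad g(k)=c\,k^{-1/2}\to0\ (k\to\infty),$$ independently of $\mu$.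
   Context: Fix positive integers $L,M,N$ and coarse sizes $\tilde M\le M$, $\tilde N\le N$. $\mathbf{Q}=(q_{m,j})\in\mathbb{R}^{M\times M}$ with $q_{m,j}=\int_0^{\tau_m}\ell_j(s)\,ds$ is the collocation matrix for the (right) Gauss–Radau nodes $0<\tau_1<\dots<\tau_M=1$ on $[0,1]$. LU trick: $\mathbf{Q}^T=\mathbf{L}_Q\mathbf{U}_Q$ with $\mathbf{L}_Q$ unit lower triangular, $\mathbf{U}_Q$ upper triangular, $\mathbf{Q}_\Delta=\mathbf{U}_Q^T$. $\tilde{\mathbf{Q}}_\Delta\in\mathbb{R}^{\tilde M\times\tilde M}$ is the lower-triangular weight matrix of a simpler quadrature rule on the coarse nodes, assumed invertible (standing assumption of the stiff-limit analysis). $\mathbf{A}\in\mathbb{C}^{N\times N}$, $\tilde{\mathbf{A}}\in\mathbb{C}^{\tilde N\times\tilde N}$, $\mu>0$. $\mathbf{N}_M$, $\tilde{\mathbf{N}}_{\tilde M}$ are the $M\times M$, $\tilde M\times\tilde M$ matrices with ones in the last column and zeros elsewhere; $\mathbf{H}=\mathbf{N}_M\otimes\mathbf{I}_N$, $\tilde{\mathbf{H}}=\tilde{\mathbf{N}}_{\tilde M}\otimes\mathbf{I}_{\tilde N}$; $\mathbf{E}\in\mathbb{R}^{L\times L}$ has ones on the first subdiagonal and zeros elsewhere. $\mathbf{C}=\mathbf{I}_{LMN}-\mu\,\mathbf{I}_L\otimes\mathbf{Q}\otimes\mathbf{A}-\mathbf{E}\otimes\mathbf{H}$, modified fine preconditioner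 $\hat{\mathbf{P}}_2=\mathbf{I}_{LMN}-\mu\,\mathbf{I}_L\otimes2\mathbf{Q}_\Delta\otimes\mathbf{A}$, coarse preconditioner $\tilde{\mathbf{P}}=\mathbf{I}_{L\tilde M\tilde N}-\mu\,\mathbf{I}_L\otimes\tilde{\mathbf{Q}}_\Delta\otimes\tilde{\mathbf{A}}-\mathbf{E}\otimes\tilde{\mathbf{H}}$ (both invertible). $\mathbf{T}_F^C=\mathbf{I}_L\otimes\mathbf{T}_{F,Q}^C\otimes\mathbf{T}_{F,A}^C\in\mathbb{R}^{L\tilde M\tilde N\times LMN}$, $\mathbf{T}_C^F=\mathbf{I}_L\otimes\mathbf{T}_{C,Q}^F\otimes\mathbf{T}_{C,A}^F\in\mathbb{R}^{LMN\times L\tilde M\tilde N}$, with $(\mathbf{E}\otimes\tilde{\mathbf{H}})\mathbf{T}_F^C=\mathbf{T}_F^C(\mathbf{E}\otimes\mathbf{H})$. $\|\cdot\|$ is an induced matrix norm. *)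

(* Defs.v *)
From HB Require Import structures.
From mathcomp Require Import all_boot all_order all_algebra.
From mathcomp Require Import classical_sets boolp reals trigo.
From mathcomp Require Import complex mxtens.
Set Implicit Arguments. Unset Strict Implicit. Unset Printing Implicit Defensive.
Import Order.TTheory GRing.Theory Num.Theory.
Local Open Scope ring_scope.
Local Open Scope complex_scope.
Local Open Scope classical_set_scope.

Section Defs.
Variable R : realType.

Definition Idm (n : nat) : 'M[R]_n := 1%:M.

Definition prim (p : {poly R}) : {poly R} :=
  \poly_(i < (size p).+1) (if i is j.+1 then p`_j / j.+1%:R else 0).

Definition intpoly (p : {poly R}) (a b : R) : R := (prim p).[b] - (prim p).[a].

Definition lagrange (M : nat) (tau : 'I_M -> R) (j : 'I_M) : {poly R} :=
  \prod_(i < M | i != j) (('X - (tau i)%:P) * ((tau j - tau i)^-1)%:P).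

(* right Gauss-Radau nodes on [0,1]:  0 < tau_1 < ... < tau_M = 1  and the
   interpolatory quadrature rule on these nodes is exact for all polynomials of
   degree <= 2M-2 (maximal degree of exactness with the endpoint 1 fixed). *)
Definition is_right_radau (M : nat) (tau : 'I_M -> R) : Prop :=
  [/\ forall i : 'I_M, 0 < tau i,
      forall i j : 'I_M, (i < j)%N -> tau i < tau j,
      forall i : 'I_M, i.+1 = M -> tau i = 1 &
      forall p : {poly R}, (size p <= (2 * M).-1)%N ->
        intpoly p 0 1 = \sum_(j < M) intpoly (lagrange tau j) 0 1 * p.[tau j]].

Definition Qcol (M : nat) (tau : 'I_M -> R) : 'M[R]_M :=
  \matrix_(m, j) intpoly (lagrange tau j) 0 (tau m).

Definition lower_tri (n : nat) (B : 'M[R]_n) : Prop :=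
  forall i j : 'I_n, (i < j)%N -> B i j = 0.
Definition upper_tri (n : nat) (B : 'M[R]_n) : Prop :=
  forall i j : 'I_n, (j < i)%N -> B i j = 0.
Definition unit_lower_tri (n : nat) (B : 'M[R]_n) : Prop :=
  lower_tri B /\ forall i, B i i = 1.

Definition Nlast (n : nat) : 'M[R]_n :=
  \matrix_(i, j) (if (j.+1 == n)%N then 1 else 0).
Definition Esub (n : nat) : 'M[R]_n :=
  \matrix_(i, j) (if (i == j.+1 :> nat) then 1 else 0).

Definition mxC (m n : nat) (B : 'M[R]_(m, n)) : 'M[R[i]]_(m, n) :=
  map_mx (fun x => x%:C) B.

Definition is_vnorm (n : nat) (nu : 'cV[R[i]]_n -> R) : Prop :=
  [/\ forall x, 0 <= nu x,
      forall x, nu x = 0 -> x = 0,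
      forall (a : R[i]) x, nu (a *: x) = Normc.normc a * nu x &
      forall x y, nu (x + y) <= nu x + nu y].

Definition opnorm (n : nat) (nu : 'cV[R[i]]_n -> R) (B : 'M[R[i]]_n) : R :=
  sup [set nu (B *m x) / nu x | x in [set x : 'cV[R[i]]_n | x != 0]].

Definition Cmat (L M N : nat) (mu : R) (Q : 'M[R]_M) (A : 'M[R[i]]_N)
  : 'M[R[i]]_(L * M * N) :=
  1%:M - mu%:C *: (mxC (Idm L *t Q) *t A)
       - mxC ((Esub L *t Nlast M) *t (Idm N)).

Definition P2hat (L M N : nat) (mu : R) (QD : 'M[R]_M) (A : 'M[R[i]]_N)
  : 'M[R[i]]_(L * M * N) :=
  1%:M - mu%:C *: (mxC (Idm L *t (2%:R *: QD)) *t A).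

Definition Ptilde (L Mt Nt : nat) (mu : R) (QtD : 'M[R]_Mt) (At : 'M[R[i]]_Nt)
  : 'M[R[i]]_(L * Mt * Nt) :=
  1%:M - mu%:C *: (mxC (Idm L *t QtD) *t At)
       - mxC ((Esub L *t Nlast Mt) *t (Idm Nt)).

Definition T2 (L M N : nat) (mu : R) (Q QD : 'M[R]_M) (A : 'M[R[i]]_N)
  : 'M[R[i]]_(L * M * N) :=
  1%:M - invmx (P2hat L mu QD A) *m Cmat L mu Q A.

Definition TPFASST (L M N Mt Nt : nat) (mu : R) (k : nat)
  (Q QD : 'M[R]_M) (A : 'M[R[i]]_N) (QtD : 'M[R]_Mt) (At : 'M[R[i]]_Nt)
  (TFC : 'M[R]_(L * Mt * Nt, L * M * N)) (TCF : 'M[R]_(L * M * N, L * Mt * Nt))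
  : 'M[R[i]]_(L * M * N) :=
  (1%:M - mxC TCF *m invmx (Ptilde L mu QtD At) *m mxC TFC *m Cmat L mu Q A)
  *m (T2 L mu Q QD A) ^+ k.

End Defs.

(* Main.v *)
Require Import Defs.
From HB Require Import structures.
From mathcomp Require Import all_boot all_order all_algebra.
From mathcomp Require Import classical_sets boolp reals trigo.
From mathcomp Require Import topology normedtype derive.
From mathcomp Require Import complex mxtens lra ring.
Set Implicit Arguments. Unset Strict Implicit. Unset Printing Implicit Defensive.
Import Order.TTheory GRing.Theory Num.Theory.
Import numFieldNormedType.Exports.
Local Open Scope ring_scope.

(** The iteration matrix factors as
    (C^-1 - T_C^F Pt^-1 T_F^C) (C T_2^k).
    Both C and Pt have the form B - mu K with K invertible: for C this needs the
    collocation matrix Q to be invertible.  A Neumann argument then bounds both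
    inverses by O(1/mu), and this cancels the factor mu in the smoothing
    property of C T_2^k.  Equivalence of norms on C^n transfers the estimates
    from the entrywise sum norm to the given operator norm. *)

(** * Entrywise sum norm and inverses of stiff pencils *)

Section MatrixSumNorm.
Variable R : realType.
Local Notation normc := (@Normc.normc R).

Lemma normc_ge0 (x : R[i]) : 0 <= normc x.
Proof. by case: x => a b; exact: sqrtr_ge0. Qed.

Lemma normcD (x y : R[i]) : normc (x + y) <= normc x + normc y.
Proof. exact: le_normcD. Qed.

Lemma normc_real (a : R) : 0 <= a -> normc (real_complex R a) = a.
Proof. by move=> a0; rewrite /= expr0n addr0 sqrtr_sqr ger0_norm. Qed.

Lemma normc_le_ReDIm (a b : R) : normc (Complex a b) <= `|a| + `|b|.
Proof.
have h0 : 0 <= `|a| + `|b| by rewrite addr_ge0.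
rewrite /= -[leRHS]ger0_norm // -sqrtr_sqr ler_sqrt ?sqr_ge0 //.
rewrite sqrrD !real_normK ?num_real // lerD2r lerDl.
by rewrite mulrn_wge0 // mulr_ge0.
Qed.

(** Defined for all shapes, so that one norm measures vectors, square matrices and the rectangular
    transfer operators. It is submultiplicative, but the identity of size n has norm n. *)
Definition mxnorm1 (m n : nat) (B : 'M[R[i]]_(m, n)) : R :=
  \sum_i \sum_j normc (B i j).

Lemma mxnorm1_ge0 m n (B : 'M_(m, n)) : 0 <= mxnorm1 B.
Proof. by apply: sumr_ge0 => i _; apply: sumr_ge0 => j _; exact: normc_ge0. Qed.

Lemma normc_le_mxnorm1 m n (B : 'M_(m, n)) i j : normc (B i j) <= mxnorm1 B.
Proof.
rewrite /mxnorm1 (bigD1 i) //= (bigD1 j) //= -addrA lerDl addr_ge0 //.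
  by apply: sumr_ge0 => ? _; exact: normc_ge0.
by apply: sumr_ge0 => ? _; apply: sumr_ge0 => ? _; exact: normc_ge0.
Qed.

Lemma mxnorm1_eq0 m n (B : 'M_(m, n)) : mxnorm1 B = 0 -> B = 0.
Proof.
move=> B0; apply/matrixP => i j; rewrite mxE; apply: Normc.eq0_normc.
by apply/eqP; rewrite eq_le normc_ge0 -B0 normc_le_mxnorm1.
Qed.

Lemma mxnorm1D m n (B C : 'M_(m, n)) : mxnorm1 (B + C) <= mxnorm1 B + mxnorm1 C.
Proof.
rewrite /mxnorm1 -big_split; apply: ler_sum => i _ /=.
rewrite -big_split; apply: ler_sum => j _ /=.
by rewrite mxE normcD.
Qed.

Lemma mxnorm1Z m n (a : R[i]) (B : 'M_(m, n)) :
  mxnorm1 (a *: B) = normc a * mxnorm1 B.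
Proof.
rewrite /mxnorm1 mulr_sumr; apply: eq_bigr => i _.
by rewrite mulr_sumr; apply: eq_bigr => j _; rewrite mxE Normc.normcM.
Qed.

Lemma mxnorm1N m n (B : 'M_(m, n)) : mxnorm1 (- B) = mxnorm1 B.
Proof.
by apply: eq_bigr => i _; apply: eq_bigr => j _; rewrite mxE normcN.
Qed.

Lemma normc_sum (I : Type) (r : seq I) (F : I -> R[i]) :
  normc (\sum_(i <- r) F i) <= \sum_(i <- r) normc (F i).
Proof.
elim/big_rec2: _ => [|i y x _ h]; first by rewrite Normc.normc0.
by apply: le_trans (normcD _ _) _; rewrite lerD2l.
Qed.

Lemma mxnorm1M m n p (B : 'M_(m, n)) (C : 'M_(n, p)) :
  mxnorm1 (B *m C) <= mxnorm1 B * mxnorm1 C.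
Proof.
rewrite /mxnorm1 mulr_suml; apply: ler_sum => i _.
apply: (@le_trans _ _ (\sum_j \sum_l normc (B i l) * normc (C l j))).
  apply: ler_sum => j _; rewrite mxE; apply: le_trans (normc_sum _ _) _.
  by apply: ler_sum => l _; rewrite Normc.normcM.
rewrite exchange_big /= mulr_suml; apply: ler_sum => l _.
rewrite -mulr_sumr ler_wpM2l ?normc_ge0 // (bigD1 l) //= lerDl.
by apply: sumr_ge0 => ? _; apply: sumr_ge0 => ? _; exact: normc_ge0.
Qed.

(** If v = v X, then the norm of v is at most half of itself, so v = 0. The bound comes from Y = 1 +
    X Y, with no geometric series; the norm of the identity stays as a factor because it need not be
    1. *)
Lemma invmx_1Bsmall n (X : 'M[R[i]]_n) : mxnorm1 X <= 2^-1 ->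
  1%:M - X \in unitmx
  /\ mxnorm1 (invmx (1%:M - X)) <= 2 * mxnorm1 (1%:M : 'M[R[i]]_n).
Proof.
move=> hX.
have uX : 1%:M - X \in unitmx.
  rewrite -row_free_unit; apply: inj_row_free => v.
  rewrite mulmxBr mulmx1 => /eqP; rewrite subr_eq0 => /eqP vX.
  apply: mxnorm1_eq0; have := mxnorm1M v X; rewrite -vX.
  have := mxnorm1_ge0 v; nra.
split => //; set Y := invmx _.
have : mxnorm1 Y <= mxnorm1 (1%:M : 'M[R[i]]_n) + mxnorm1 X * mxnorm1 Y.
  have {1}-> : Y = 1%:M + X *m Y.
    by rewrite -(mulmxV uX) mulmxBl mul1mx subrK.
  by apply: le_trans (mxnorm1D _ _) _; rewrite lerD2l mxnorm1M.
have := mxnorm1_ge0 Y; have := mxnorm1_ge0 X; nra.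
Qed.

(** Factor B - mu K = (- mu K) (1 - mu^-1 K^-1 B). Once mu is at least twice the norm of K^-1 B, the
    second factor has a bounded inverse, and the first one contributes 1/mu. *)
Lemma invmx_large_pencil n (B K : 'M[R[i]]_n) : K \in unitmx ->
  exists2 c : R, 0 < c & exists2 mu0 : R, 0 < mu0 & forall mu : R, mu0 <= mu ->
    B - real_complex R mu *: K \in unitmx
    /\ mxnorm1 (invmx (B - real_complex R mu *: K)) <= c / mu.
Proof.
move=> uK; pose W := invmx K *m B; pose i1 := mxnorm1 (1%:M : 'M[R[i]]_n).
have W0 := mxnorm1_ge0 W; have i0 : 0 <= i1 := mxnorm1_ge0 _.
have K0 := mxnorm1_ge0 (invmx K).
(* The added 1 here and in the threshold keeps both constants strictly positive even if the norms
   vanish. *)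
exists (2 * i1 * mxnorm1 (invmx K) + 1); first by rewrite ltr_wpDl ?mulr_ge0.
exists (2 * mxnorm1 W + 1) => [|mu hmu]; first by lra.
have mu0 : 0 < mu by lra.
have muC : real_complex R mu != 0.
  by rewrite (inj_eq (@complexI R) mu 0) gt_eqF.
have nmuV : normc (real_complex R mu)^-1 = mu^-1.
  by rewrite Normc.normcV normc_real // ltW.
pose X := (real_complex R mu)^-1 *: W.
have [|uX hX] := @invmx_1Bsmall _ X.
  by rewrite mxnorm1Z nmuV mulrC ler_pdivrMr //; lra.
have fact : B - real_complex R mu *: K = (- real_complex R mu *: K) *m (1%:M - X).
  rewrite mulmxBr mulmx1 /X /W -!scalemxAr -!scalemxAl scalerA mulrN mulVf //.
  by rewrite mulKVmx // scaleN1r opprK scaleNr addrC.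
have uc : (- real_complex R mu *: K) \in unitmx.
  by rewrite unitmxZ // unitfE oppr_eq0.
split; rewrite fact ?unitmx_mul ?uc ?uX //.
have -> : invmx (- real_complex R mu *: K *m (1%:M - X))
    = invmx (1%:M - X) *m ((- real_complex R mu)^-1 *: invmx K).
  have u : - real_complex R mu *: K *m (1%:M - X) \in unitmx.
    by rewrite unitmx_mul uc uX.
  apply: (can_inj (mulKmx u)); rewrite mulmxV //.
  rewrite mulmxA mulmxK // -scalemxAl -scalemxAr scalerA mulmxV //.
  by rewrite mulfV ?scale1r // oppr_eq0.
apply: le_trans (mxnorm1M _ _) _.
rewrite mxnorm1Z invrN normcN nmuV mulrCA [_ / mu]mulrC.
apply: ler_wpM2l; first by rewrite invr_ge0 ltW.
by apply: le_trans (ler_wpM2r K0 hX) _; rewrite lerDl.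
Qed.

End MatrixSumNorm.

(** * Invertibility of the collocation matrix *)

Section CollocationMatrix.
Variable R : realType.

Lemma coef_prim (p : {poly R}) i :
  (prim p)`_i = if i is j.+1 then p`_j / j.+1%:R else 0.
Proof.
rewrite coef_poly; case: ltnP => // hi; case: i hi => // j hj.
by rewrite nth_default ?mul0r.
Qed.

Lemma prim0 : prim (0 : {poly R}) = 0.
Proof. by apply/polyP => -[|i]; rewrite coef_prim !coef0 ?mul0r. Qed.

Lemma primD (p q : {poly R}) : prim (p + q) = prim p + prim q.
Proof.
by apply/polyP => -[|i]; rewrite coefD !coef_prim ?addr0 // coefD mulrDl.
Qed.

Lemma primZ (a : R) (p : {poly R}) : prim (a *: p) = a *: prim p.
Proof.
by apply/polyP => -[|i]; rewrite coefZ !coef_prim ?mulr0 // coefZ mulrA.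
Qed.

Lemma prim_eq0 (p : {poly R}) : prim p = 0 -> p = 0.
Proof.
move=> h; apply/polyP => i; have := congr1 (fun q : {poly R} => q`_i.+1) h.
rewrite /= coef_prim !coef0 => /eqP; rewrite mulf_eq0 invr_eq0 pnatr_eq0 orbF.
by move/eqP.
Qed.

Lemma horner_prim0 (p : {poly R}) : (prim p).[0] = 0.
Proof. by rewrite horner_coef0 coef_prim. Qed.

(** A product of M - 1 factors of size at most 2. Only an upper bound holds: at coinciding nodes the
    inverse is 0 by convention, and so is the factor. *)
Lemma size_lagrange (M : nat) (tau : 'I_M -> R) j :
  (size (Defs.lagrange tau j) <= M)%N.
Proof.
have M0 : (0 < M)%N by case: M tau j => [? []|].
apply: leq_trans (size_prod_leq _ _) _.
rewrite leq_subLR -[X in (_ <= X)%N]/(_ + _)%N.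
have cM : #|[pred i : 'I_M | i != j]| = M.-1.
  by rewrite cardC1 card_ord.
rewrite cM; apply: (@leq_ltn_trans (\sum_(i < M | i != j) 2)%N).
  apply: leq_sum => i _; apply: leq_trans (size_polyMleq _ _) _.
  rewrite size_XsubC; have := size_polyC_leq1 ((tau j - tau i)^-1).
  by case: (size _) => [|[]].
by rewrite sum_nat_const cM; case: (M) M0 => // m _; rewrite /= muln2 -addnn addnS.
Qed.

Lemma horner_lagrange (M : nat) (tau : 'I_M -> R) (i j : 'I_M) :
  injective tau -> (Defs.lagrange tau j).[tau i] = (i == j)%:R.
Proof.
move=> tau_inj; rewrite horner_prod; have [->|ij] := eqVneq i j.
  rewrite big1 // => l lj; rewrite !hornerE mulfV // subr_eq0.
  by rewrite (inj_eq tau_inj) eq_sym.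
by rewrite (bigD1 i) //= !hornerE subrr !mul0r.
Qed.

(* A kernel vector of Q lists the node values of a polynomial of degree < M
   whose primitive vanishes at the M + 1 points 0, tau_1, ..., tau_M. *)
Lemma Qcol_unit (M : nat) (tau : 'I_M -> R) :
  injective tau -> (forall i, 0 < tau i) -> Qcol tau \in unitmx.
Proof.
move=> tau_inj tau_gt0; rewrite -unitmx_tr -row_free_unit.
apply: inj_row_free => v hv.
pose p := \sum_j v 0 j *: Defs.lagrange tau j.
have primp x : (prim p).[x] = \sum_j v 0 j * (prim (Defs.lagrange tau j)).[x].
  rewrite /p; elim/big_rec2: _ => [|j y q _ <-]; first by rewrite prim0 horner0.
  by rewrite primD primZ hornerD hornerZ.
have p0 : p = 0.
  apply: prim_eq0; apply/eqP; apply: contraT => nz.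
  (* A nonzero primitive with M + 1 distinct roots would have size at least M + 2, but its size is
     at most M + 1. *)
  suff : (size (0%R :: [seq tau i | i <- enum 'I_M]) < size (prim p))%N.
    rewrite /= size_map size_enum_ord ltnNge.
    suff -> : (size (prim p) <= M.+1)%N by [].
    apply: leq_trans (size_poly _ _) _; rewrite ltnS.
    apply: leq_trans (size_sum _ _ _) _; apply/bigmax_leqP => j _.
    exact: leq_trans (size_scale_leq _ _) (size_lagrange _ _).
  apply: max_poly_roots => //.
    rewrite /= /root horner_prim0 eqxx /=; apply/allP => _ /mapP[i _ ->].
    apply/eqP; rewrite primp; transitivity ((v *m (Qcol tau)^T) 0 i).
      rewrite mxE; apply: eq_bigr => j _.
      by rewrite !mxE /intpoly horner_prim0 subr0.
    by rewrite hv mxE.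
  rewrite /= map_inj_uniq // enum_uniq andbT; apply/mapP => -[i _ h].
  by have := tau_gt0 i; rewrite -h ltxx.
(* Evaluating p = 0 at the node [tau i] leaves exactly the coefficient [v 0 i]. *)
apply/rowP => i; rewrite mxE.
have := congr1 (fun q : {poly R} => q.[tau i]) p0.
rewrite /= horner0 horner_sum (bigD1 i) //= big1 => [|j ji].
  by rewrite hornerZ horner_lagrange // eqxx mulr1 addr0.
by rewrite hornerZ horner_lagrange // eq_sym (negbTE ji) mulr0.
Qed.

End CollocationMatrix.

(** * Equivalence of norms and operator norm estimates *)

Section OperatorNorm.
Variables (R : realType) (n : nat) (nu : 'cV[R[i]]_n -> R).
Hypothesis nuP : is_vnorm nu.

Lemma vnorm0 : nu 0 = 0.
Proof.
by case: nuP => _ _ nuZ _; rewrite -(scale0r 0) nuZ Normc.normc0 mul0r.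
Qed.

(** Expand x in the canonical basis; the constant is the sum of the norms of the basis vectors, plus
    1 for strict positivity. *)
Lemma vnorm_le_mxnorm1 :
  exists2 K : R, 0 < K & forall x, nu x <= K * mxnorm1 x.
Proof.
case: nuP => nu0 _ nuZ nuD.
pose S := \sum_i nu (delta_mx i 0); have S0 : 0 <= S by apply: sumr_ge0.
exists (S + 1) => [|x]; first by rewrite ltr_wpDl.
have nu_sum (r : seq 'I_n) (F : 'I_n -> 'cV[R[i]]_n) :
    nu (\sum_(i <- r) F i) <= \sum_(i <- r) nu (F i).
  elim/big_rec2: _ => [|i y z _ h]; first by rewrite vnorm0.
  by apply: le_trans (nuD _ _) _; rewrite lerD2l.
have {1}-> : x = \sum_i x i 0 *: delta_mx i 0.
  by rewrite {1}(matrix_sum_delta x); apply: eq_bigr => i _; rewrite big_ord1.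
apply: le_trans (nu_sum _ _) _.
apply: (@le_trans _ _ (S * mxnorm1 x)); last first.
  by rewrite ler_wpM2r ?mxnorm1_ge0 // lerDl.
rewrite mulr_suml; apply: ler_sum => i _.
by rewrite nuZ mulrC ler_wpM2l // normc_le_mxnorm1.
Qed.

(** Identification of R^(2n) with C^n, which makes compactness and the extreme value theorem for
    real row vectors available for complex columns. *)
Definition cplx_col (v : 'rV[R]_(n + n)) : 'cV[R[i]]_n :=
  \col_i Complex (v 0 (lshift n i)) (v 0 (rshift n i)).

Lemma cplx_colB v w : cplx_col (v - w) = cplx_col v - cplx_col w.
Proof. by apply/colP => i; rewrite !mxE. Qed.

Lemma cplx_colZ (a : R) v : cplx_col (a *: v) = real_complex R a *: cplx_col v.
Proof.
by apply/colP => i; rewrite !mxE /=; congr Complex; rewrite mul0r ?subr0 ?addr0.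
Qed.

Lemma cplx_col_eq0 v : cplx_col v = 0 -> v = 0.
Proof.
move=> /colP h; apply/rowP => i; rewrite mxE; case: (split_ordP i) => j ->.
  by have := h j; rewrite !mxE => -[].
by have := h j; rewrite !mxE => -[].
Qed.

Lemma cplx_col_surj x : exists v, cplx_col v = x.
Proof.
exists (row_mx (\row_i complex.Re (x i 0)) (\row_i complex.Im (x i 0))).
by apply/colP => i; rewrite mxE row_mxEl row_mxEr !mxE; case: (x i 0).
Qed.

Lemma row_entry_le_norm m (v : 'rV[R]_m) i : `|v 0 i| <= `|v|.
Proof.
rewrite [leRHS]/Num.Def.normr /= mx_normrE.
exact: (le_bigmax _ (fun ij => `|v ij.1 ij.2|) (0, i)).
Qed.

(** Real rows carry the maximum norm, so each of the n complex entries contributes at most twice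
    [|v|]. *)
Lemma mxnorm1_cplx_col v : mxnorm1 (cplx_col v) <= (2 * n)%:R * `|v|.
Proof.
apply: (@le_trans _ _ (\sum_(i < n) 2 * `|v|)).
  apply: ler_sum => i _; rewrite big_ord1 mxE.
  apply: le_trans (normc_le_ReDIm _ _) _.
  by rewrite mulr2n mulrDl !mul1r lerD // row_entry_le_norm.
by rewrite sumr_const card_ord natrM -[leLHS]mulr_natl mulrCA mulrA.
Qed.

(** The reverse triangle inequality and the bound by the sum norm make this map Lipschitz. *)
Lemma vnorm_cplx_col_continuous : continuous (fun v => nu (cplx_col v)).
Proof.
case: nuP => nu0 _ nuZ nuD; have [K K0 hK] := vnorm_le_mxnorm1.
have nuN x : nu (- x) = nu x.
  by rewrite -scaleN1r nuZ normcN Normc.normc1 mul1r.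
have lip v w : `|nu (cplx_col v) - nu (cplx_col w)| <= K * (2 * n)%:R * `|v - w|.
  apply: (@le_trans _ _ (nu (cplx_col (v - w)))); last first.
    by apply: le_trans (hK _) _; rewrite -mulrA ler_wpM2l ?mxnorm1_cplx_col // ltW.
  rewrite cplx_colB ler_norml; apply/andP; split.
    rewrite lerNl opprB lerBlDr -(nuN (_ - _)) opprB.
    by apply: le_trans (nuD _ _); rewrite subrK.
  by rewrite lerBlDr; apply: le_trans (nuD _ _); rewrite subrK.
pose c := K * (2 * n)%:R + 1.
have c0 : 0 < c by rewrite ltr_wpDl // mulr_ge0 // ltW.
move=> v; have FF := nbhs_filter (v : 'rV[R]_(n + n)).
apply/cvgrPdist_lt => e e0.
have ec0 : 0 < e / c by exact: divr_gt0.
apply: filterS (nbhsx_ballx (v : 'rV[R]_(n + n)) _ ec0) => w.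
rewrite -ball_normE /= => vw; apply: le_lt_trans (lip _ _) _.
apply: (@le_lt_trans _ _ (c * `|v - w|)); first by rewrite ler_wpM2r // lerDl.
by rewrite -ltr_pdivlMl // mulrC.
Qed.

(* Compactness of the unit sphere of R^(2n) gives the nontrivial
   half of the equivalence of norms. *)
Lemma mxnorm1_le_vnorm : (0 < n)%N ->
  exists2 K : R, 0 < K & forall x, mxnorm1 x <= K * nu x.
Proof.
move=> n0; case: (nuP) => nu0 nu_eq0 nuZ nuD.
pose A := [set v : 'rV[R]_(n + n) | `|v| = 1]%classic.
have cA : compact A.
  apply: bounded_closed_compact.
    exists 1; split; first exact: num_real.
    by move=> M hM v; rewrite /A /= => ->; exact: ltW.
  apply: (@closed_comp _ _ (fun v : 'rV[R]_(n + n) => `|v|) [set 1]%classic).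
    by move=> v _; exact: norm_continuous.
  exact: closed_eq.
have unit_norm (v : 'rV[R]_(n + n)) : v != 0 -> A (`|v|^-1 *: v).
  move=> v0; rewrite /A /= normrZ ger0_norm ?invr_ge0 //.
  by rewrite mulVf // normr_eq0.
have A0 : (A !=set0)%classic.
  pose v : 'rV[R]_(n + n) := const_mx 1.
  exists (`|v|^-1 *: v); apply: unit_norm; apply/eqP => /rowP.
  move=> /(_ (lshift n (Ordinal n0))); rewrite !mxE => /eqP.
  by rewrite oner_eq0.
have [c cinA cmin] := @EVT_min_rV _ _ _ _ A0 cA
  (continuous_subspaceT vnorm_cplx_col_continuous).
have fc0 : 0 < nu (cplx_col c).
  rewrite lt_neqAle nu0 andbT eq_sym; apply/eqP => /nu_eq0 /cplx_col_eq0 c0.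
  move: cinA; rewrite inE /A /= c0 normr0 => /eqP.
  by rewrite eq_sym oner_eq0.
(* On the unit sphere the sum norm is at most 2n and [nu] is at least its minimum, attained at [c];
   homogeneity extends the ratio to all vectors. *)
exists ((2 * n)%:R / nu (cplx_col c)).
  by rewrite divr_gt0 // ltr0n muln_gt0.
move=> x; have [v <-] := cplx_col_surj x.
apply: le_trans (mxnorm1_cplx_col _) _.
rewrite -mulrA ler_wpM2l // mulrC ler_pdivlMr //.
have [->|v0] := eqVneq v 0; first by rewrite normr0 mul0r.
have vn : 0 < `|v| by rewrite normr_gt0.
have /cmin : `|v|^-1 *: v \in A by rewrite inE; exact: unit_norm.
rewrite cplx_colZ nuZ normc_real ?invr_ge0 //.
by rewrite mulrC ler_pdivlMr // mulrC.
Qed.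

Hypothesis n_gt0 : (0 < n)%N.

Lemma opnorm_set_nonempty (B : 'M[R[i]]_n) :
  ([set nu (B *m x) / nu x | x in [set x : 'cV[R[i]]_n | x != 0]] !=set0)%classic.
Proof.
exists (nu (B *m const_mx 1) / nu (const_mx 1)); exists (const_mx 1) => //=.
apply/eqP => /colP /(_ (Ordinal n_gt0)); rewrite !mxE => /eqP.
by rewrite oner_eq0.
Qed.

Lemma vnorm_gt0 x : x != 0 -> 0 < nu x.
Proof.
case: nuP => nu0 nu_eq0 _ _ x0; rewrite lt_neqAle nu0 andbT eq_sym.
by apply: contra x0 => /eqP/nu_eq0/eqP.
Qed.

Lemma opnorm_le (B : 'M[R[i]]_n) (b : R) :
  (forall x, nu (B *m x) <= b * nu x) -> opnorm nu B <= b.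
Proof.
move=> h; apply: ge_sup; first exact: opnorm_set_nonempty.
by move=> _ [x /= x0 <-]; rewrite ler_pdivrMr // vnorm_gt0.
Qed.

(** Pass to the sum norm, use its submultiplicativity, and pass back. *)
Lemma vnorm_mulmx_le : exists2 K : R, 0 < K &
  forall (B : 'M[R[i]]_n) x, nu (B *m x) <= K * mxnorm1 B * nu x.
Proof.
have [K1 K10 h1] := vnorm_le_mxnorm1; have [K2 K20 h2] := mxnorm1_le_vnorm n_gt0.
exists (K1 * K2) => [|B x]; first exact: mulr_gt0.
apply: le_trans (h1 _) _; rewrite -!mulrA ler_wpM2l ?(ltW K10) //.
apply: le_trans (mxnorm1M _ _) _; rewrite mulrCA.
by rewrite ler_wpM2l ?mxnorm1_ge0.
Qed.

(* Boundedness has to be known first: [sup] of an unbounded set is [0]. *)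
Lemma vnorm_mulmx_opnorm (B : 'M[R[i]]_n) x : nu (B *m x) <= opnorm nu B * nu x.
Proof.
have [K K0 hK] := vnorm_mulmx_le.
have [->|x0] := eqVneq x 0; first by rewrite mulmx0 vnorm0 mulr0.
rewrite -ler_pdivrMr ?vnorm_gt0 //; apply: ub_le_sup; last by exists x.
by exists (K * mxnorm1 B) => _ [y /= y0 <-]; rewrite ler_pdivrMr // vnorm_gt0.
Qed.

(** The mixed form fits the two available estimates: the inverses are bounded in the sum norm, the
    smoothing property in the operator norm. *)
Lemma opnorm_mulmx_le : exists2 K : R, 0 < K &
  forall B C : 'M[R[i]]_n, opnorm nu (B *m C) <= K * mxnorm1 B * opnorm nu C.
Proof.
have [K K0 hK] := vnorm_mulmx_le; exists K => // B C; apply: opnorm_le => x.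
rewrite -mulmxA; apply: le_trans (hK _ _) _; rewrite -[leRHS]mulrA ler_wpM2l //.
  by rewrite mulr_ge0 ?mxnorm1_ge0 // ltW.
exact: vnorm_mulmx_opnorm.
Qed.

End OperatorNorm.

(** * Decay of the inverses of the fine and coarse systems *)

Section StiffPencils.
Variable R : realType.

Lemma mxC_unit n (B : 'M[R]_n) : (mxC B \in unitmx) = (B \in unitmx).
Proof. exact: (map_unitmx (real_complex R)). Qed.

Lemma stiff_pencil_unit (L M N : nat) (Q : 'M[R]_M) (A : 'M[R[i]]_N) :
  (0 < L)%N -> (0 < M)%N -> (0 < N)%N -> Q \in unitmx -> A \in unitmx ->
  mxC (Idm R L *t Q) *t A \in unitmx.
Proof.
move=> L0 M0 N0 uQ uA; rewrite tensmx_unit // -?lt0n ?muln_gt0 ?L0 //.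
by rewrite mxC_unit tensmx_unit ?unitmx1 // -lt0n.
Qed.

(* [Ptilde L mu QtD At] is convertible to [Cmat L mu QtD At], so this also
   covers the coarse preconditioner. *)
Lemma Cmat_inv_bound (L M N : nat) (Q : 'M[R]_M) (A : 'M[R[i]]_N) :
  (0 < L)%N -> (0 < M)%N -> (0 < N)%N -> Q \in unitmx -> A \in unitmx ->
  exists2 c : R, 0 < c & exists2 mu0 : R, 0 < mu0 & forall mu : R, mu0 <= mu ->
    Cmat L mu Q A \in unitmx /\ mxnorm1 (invmx (Cmat L mu Q A)) <= c / mu.
Proof.
move=> L0 M0 N0 uQ uA; have uK := stiff_pencil_unit L0 M0 N0 uQ uA.
(* The pencil has the [mu]-free part 1 - E (x) H as B. *)
have [c c0 [mu0 mu00 h]] := invmx_large_pencil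
  (1%:M - mxC ((Esub R L *t Nlast R M) *t Idm R N)) uK.
by exists c => //; exists mu0 => // mu /h; rewrite /Cmat addrAC.
Qed.
End StiffPencils.

Theorem theorem5 (R : realType) (L M N Mt Nt : nat)
  (hL : (0 < L)%N) (hM : (0 < M)%N) (hN : (0 < N)%N)
  (hMt : (0 < Mt)%N) (hNt : (0 < Nt)%N) (hMtM : (Mt <= M)%N) (hNtN : (Nt <= N)%N)
  (tau : 'I_M -> R) (htau : is_right_radau tau)
  (LQ UQ : 'M[R]_M) (hLQ : unit_lower_tri LQ) (hUQ : upper_tri UQ)
  (hLU : (Qcol tau)^T = LQ *m UQ)
  (QtD : 'M[R]_Mt) (hQtD : lower_tri QtD) (hQtDinv : QtD \in unitmx)
  (A : 'M[R[i]]_N) (At : 'M[R[i]]_Nt) (hA : A \in unitmx) (hAt : At \in unitmx)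
  (TQFC : 'M[R]_(Mt, M)) (TAFC : 'M[R]_(Nt, N))
  (TQCF : 'M[R]_(M, Mt)) (TACF : 'M[R]_(N, Nt))
  (hcomm : ((Esub R L *t Nlast R Mt) *t (Idm R Nt))
             *m ((Idm R L *t TQFC) *t TAFC)
           = ((Idm R L *t TQFC) *t TAFC)
             *m ((Esub R L *t Nlast R M) *t (Idm R N)))
  (nu : 'cV[R[i]]_(L * M * N) -> R) (hnu : is_vnorm nu)
  (hinv : forall mu : R, 0 < mu ->
     P2hat L mu (UQ^T) A \in unitmx /\ Ptilde L mu QtD At \in unitmx)
  (hsmooth : exists2 c0 : R, 0 < c0 & exists2 mu0 : R, 0 < mu0 &
     forall k : nat, (0 < k)%N -> forall mu : R, mu0 <= mu ->
       opnorm nu (Cmat L mu (Qcol tau) A *m (T2 L mu (Qcol tau) (UQ^T) A) ^+ k)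
         <= c0 * Num.sqrt (8 / (k%:R * pi)) * mu) :
  exists2 c : R, 0 < c & exists2 mus : R, 0 < mus &
    forall k : nat, (0 < k)%N -> forall mu : R, mus <= mu ->
      opnorm nu (TPFASST mu k (Qcol tau) (UQ^T) A QtD At
                   ((Idm R L *t TQFC) *t TAFC)
                   ((Idm R L *t TQCF) *t TACF))
        <= c * (Num.sqrt k%:R)^-1.
Proof.
have LMN0 : (0 < L * M * N)%N by rewrite !muln_gt0 hL hM hN.
have [tau_gt0 tau_lt _ _] := htau.
have tau_inj : injective tau.
  move=> i j tij; apply: val_inj; case: (ltngtP i j) => // /tau_lt.
    by rewrite tij ltxx.
  by rewrite tij ltxx.
have uQ := Qcol_unit tau_inj tau_gt0.
have [c1 c10 [mu1 mu10 hC]] := Cmat_inv_bound hL hM hN uQ hA.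
have [c2 c20 [mu2 mu20 hP]] := Cmat_inv_bound hL hMt hNt hQtDinv hAt.
have [K K0 hK] := opnorm_mulmx_le hnu LMN0.
have [c0 c00 [mu0 mu00 hS]] := hsmooth.
set TFC := (Idm R L *t TQFC) *t TAFC; set TCF := (Idm R L *t TQCF) *t TACF.
(* Bounds [mu] times the sum norm of C^-1 - T_C^F Pt^-1 T_F^C, by the triangle inequality. *)
pose c3 := c1 + mxnorm1 (mxC TCF) * c2 * mxnorm1 (mxC TFC).
have c30 : 0 < c3.
  by rewrite ltr_wpDr // !mulr_ge0 ?mxnorm1_ge0 // ltW.
exists (K * c3 * c0 * Num.sqrt (8 / pi)).
  by rewrite !mulr_gt0 // sqrtr_gt0 divr_gt0 // pi_gt0.
(* The sum of the positive thresholds dominates each of them. *)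
exists (mu0 + mu1 + mu2) => [|k k0 mu hmu]; first by rewrite !addr_gt0.
have mu_ge0 : mu0 <= mu.
  by apply: le_trans hmu; rewrite -addrA lerDl addr_ge0 // ltW.
have mu_ge1 : mu1 <= mu.
  by apply: le_trans hmu; rewrite addrAC lerDr addr_ge0 // ltW.
have mu_ge2 : mu2 <= mu.
  by apply: le_trans hmu; rewrite lerDr addr_ge0 // ltW.
have mu_gt0 : 0 < mu by apply: lt_le_trans mu_ge0.
have [uC iC] := hC _ mu_ge1; have [_ iP] := hP _ mu_ge2.
set C := Cmat L mu (Qcol tau) A in uC iC.
set P := Cmat L mu QtD At in iP.
set T := T2 L mu (Qcol tau) UQ^T A.
(* Invertibility of C lets it be pulled out on the right of the coarse-grid correction, which
   becomes [D *m C]. *)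
pose D := invmx C - mxC TCF *m invmx P *m mxC TFC.
have -> : TPFASST mu k (Qcol tau) UQ^T A QtD At TFC TCF = D *m (C *m T ^+ k).
  by rewrite mulmxA mulmxBl mulVmx.
have hD : mxnorm1 D <= c3 / mu.
  apply: le_trans (mxnorm1D _ _) _; rewrite mxnorm1N mulrDl; apply: lerD => //.
  apply: le_trans (mxnorm1M _ _) _; rewrite mulrAC.
  apply: ler_wpM2r; first exact: mxnorm1_ge0.
  apply: le_trans (mxnorm1M _ _) _; rewrite -mulrA.
  by apply: ler_wpM2l; first exact: mxnorm1_ge0.
apply: le_trans (hK _ _) _.
have s0 : 0 <= c0 * Num.sqrt (8 / (k%:R * pi)) * mu.
  by rewrite !mulr_ge0 ?sqrtr_ge0 // ltW.
(* The factor 1/mu from [D] meets the factor mu of the smoothing property; they cancel in the final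
   [field]. *)
apply: (@le_trans _ _ (K * (c3 / mu) * (c0 * Num.sqrt (8 / (k%:R * pi)) * mu))).
  apply: (@le_trans _ _ (K * mxnorm1 D * (c0 * Num.sqrt (8 / (k%:R * pi)) * mu))).
    apply: ler_wpM2l; first by rewrite mulr_ge0 ?mxnorm1_ge0 // ltW.
    exact: hS.
  by apply: ler_wpM2r => //; apply: ler_wpM2l => //; exact: ltW.
have -> : Num.sqrt (8 / (k%:R * pi)) = Num.sqrt (8 / pi) * (Num.sqrt k%:R)^-1 :> R.
  rewrite -sqrtrV ?ler0n // -sqrtrM; last by rewrite divr_ge0 // pi_ge0.
  by rewrite invfM mulrCA mulrC.
rewrite le_eqVlt; apply/orP; left; apply/eqP; field.
by rewrite !gt_eqF // ?sqrtr_gt0 ?ltr0n.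
Qed.
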